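(* There exists a set $A\subseteq\mathbb{N}$ satisfying $A\cup(A-1)=\mathbb{N}$ that is not multiplicatively thick in any coset of any congruence subsemigroup.
   Context: $\mathbb{N}=\{1,2,\ldots\}$. For $A\subseteq\mathbb{N}$, $A-1=\{m\in\mathbb{N} : m+1\in A\}$. For $N\in\mathbb{N}$, the congruence subsemigroup $\mathbb{N}_{N,1}$ of $(\mathbb{N},\cdot)$ is $\{n\in\mathbb{N} : n\equiv1\pmod N\}$; its cosets are the sets $I\,\mathbb{N}_{N,1}=\{In : n\in\mathbb{N}_{N,1}\}$, $I\in\mathbb{N}$. A set $A\subseteq\mathbb{N}$ is multiplicatively thick in $I\,\mathbb{N}_{N,1}$ if for all finite $F\subseteq\mathbb{N}_{N,1}$ there exists $m\in\mathbb{N}_{N,1}$ such that $ImF=\{Imf : f\in F\}\subseteq A$. *)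

(* Defs.v *)
From mathcomp Require Import all_boot.
From mathcomp Require Import boolp classical_sets cardinality.

Set Implicit Arguments.
Unset Strict Implicit.
Unset Printing Implicit Defensive.

Local Open Scope classical_set_scope.

(* The natural numbers here start at 1, whereas [nat] contains 0. *)
Definition posnat : set nat := [set n | 0 < n].

(* A - 1, taken inside the positive integers: 1 \in A does not put 0 in it. *)
Definition shift_down (A : set nat) : set nat :=
  [set m | posnat m /\ A m.+1].

(* Positivity matters for N = 1, where 0 = 1 %[mod N] also holds. *)
Definition cong_semigroup (N : nat) : set nat :=
  [set n | posnat n /\ n = 1 %[mod N]].

(* Thickness in the coset I * cong_semigroup N; a coset determines its
   representative I, its least element. *)
Definition mult_thick_in_coset (I N : nat) (A : set nat) : Prop :=
  forall F : set nat, finite_set F -> F `<=` cong_semigroup N ->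
    exists2 m : nat, cong_semigroup N m & [set I * m * f | f in F] `<=` A.

(* Main.v *)
Require Import Defs.
From mathcomp Require Import all_boot.
From mathcomp Require Import boolp classical_sets cardinality.
From mathcomp Require Import zify.

Set Implicit Arguments.
Unset Strict Implicit.

Local Open Scope classical_set_scope.

(** Membership in [A] can be made to depend on the size of an integer, which
    the shift by 1 hardly changes but multiplication changes at will.

    Cut the positive integers into the dyadic intervals [2^e, 2^(e+1)) and
    let each interval work for a single coset, in such a way that every coset
    owns intervals whose exponents [e] recur with bounded gaps: the interval
    of exponent [e] belongs to the coset whose code is the 2-adic valuation
    of [e].  Let [C] ([served]) consist of the integers that lie in the coset
    owning their own interval, let [B] ([isolated]) consist of the [n] in [C]
    with [n + 1] outside [C], and let [A] be the complement of [B].  No two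
    consecutive integers are in [B], which is the covering property of [A].

    For [A] not to be thick in [I * cong_semigroup N], a finite set of
    multipliers must bring every element [I * m] of the coset into [B].  When
    [I > 1] this is so ([isolated_syndetic]): the exponents owned by the coset
    have bounded gaps, so one of them gives an interval that is longer than
    the step [I * m * N] of the progression [I * m * f], [f = 1 %[mod N]], but
    longer only by a bounded factor ([exponent_valuation]).  The progression
    thus enters the interval at a bounded [f]; the point reached is in [C],
    and the next integer, still in the interval, is no multiple of [I].
    Finally, thickness in the coset of [I] implies thickness in that of
    [I * N.+1], as [N.+1 = 1 %[mod N]], so [I > 1] may be assumed. *)

(** The pair [(I, N)] whose coset owns the dyadic interval containing [n];
    valuations that code no pair get the arbitrary value [(1, 1)]. *)
Definition owner (n : nat) : nat * nat :=
  odflt (1, 1) (unpickle (logn 2 (trunc_log 2 n))).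

Definition served (n : nat) : bool :=
  let: (i, N) := owner n in (i %| n) && (n %/ i == 1 %[mod N]).

Definition isolated (n : nat) : bool := served n && ~~ served n.+1.

Lemma owner_dyadic (I N e n : nat) :
  logn 2 e = pickle (I, N) -> 2 ^ e <= n < 2 ^ e.+1 -> owner n = (I, N).
Proof. by move=> he hn; rewrite /owner (trunc_log_eq _ hn) // he pickleK. Qed.

(** The exponents of 2-adic valuation [k] form a progression of difference
    [2 ^ k.+1]; taking one a little above [log_2 M] gives a power of 2
    exceeding [M], by a factor bounded in terms of [k] alone. *)
Lemma exponent_valuation (k M : nat) : 0 < M ->
  exists e, [/\ logn 2 e = k, M.+1 < 2 ^ e & 2 ^ e <= 2 ^ (2 ^ k.+2) * M].
Proof.
move=> M_gt0; set L := trunc_log 2 M; set j := (L %/ 2 ^ k.+1).+1.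
have /andP[leLM ltML] : 2 ^ L <= M < 2 ^ L.+1 by exact: trunc_log_bounds.
have k_gt0 : 0 < 2 ^ k by rewrite expn_gt0.
have eS : 2 ^ k.+1 = 2 * 2 ^ k by rewrite expnS.
have eSS : 2 ^ k.+2 = 4 * 2 ^ k by rewrite !expnS mulnA.
have lt_e : L.+2 <= 2 ^ k * (j.*2).+1.
  have := ltn_ceil L (expn_gt0 2 k.+1); rewrite -/j eS; nia.
have le_e : 2 ^ k * (j.*2).+1 <= 2 ^ k.+2 + L.
  have := leq_trunc_div L (2 ^ k.+1); rewrite eSS /j {2}eS; nia.
exists (2 ^ k * (j.*2).+1); split.
- rewrite lognM // pfactorK // (_ : logn 2 (j.*2).+1 = 0) ?addn0 //.
  by apply: logn_coprime; rewrite coprime2n /= odd_double.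
- apply: (@leq_trans (2 ^ L.+2)); last by rewrite leq_exp2l.
  rewrite expnS; lia.
- apply: (@leq_trans (2 ^ (2 ^ k.+2 + L))); first by rewrite leq_exp2l.
  by rewrite expnD leq_mul2l leLM orbT.
Qed.

(** The condition [1 < I] is what separates consecutive elements of the coset
    inside one interval. *)
Lemma isolated_dyadic (I N e n : nat) : 1 < I ->
    logn 2 e = pickle (I, N) -> 2 ^ e <= I * n -> (I * n).+1 < 2 ^ e.+1 ->
  n = 1 %[mod N] -> isolated (I * n).
Proof.
move=> I_gt1 he le_e lt_e nN.
have In : owner (I * n) = (I, N) by apply: (owner_dyadic he); lia.
have InS : owner (I * n).+1 = (I, N) by apply: (owner_dyadic he); lia.
rewrite /isolated /served In InS dvdn_mulr // mulKn ?(ltnW I_gt1) // nN eqxx /=.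
by rewrite -addn1 dvdn_addr ?dvdn_mulr // dvdn1; case: eqP I_gt1 => // ->.
Qed.

Lemma isolated_syndetic (I N : nat) : 1 < I -> 0 < N ->
  exists X, forall m, cong_semigroup N m ->
    exists f, [/\ cong_semigroup N f, f <= X & isolated (I * m * f)].
Proof.
move=> I_gt1 N_gt0; set Y := 2 ^ (2 ^ (pickle (I, N)).+2).
exists (N * Y.+1).+1 => m [m_gt0 mN]; rewrite /posnat /= in m_gt0.
have Im_gt0 : 0 < I * m by rewrite muln_gt0 m_gt0 (ltnW I_gt1).
set M := I * m * N.
have M_gt0 : 0 < M by rewrite muln_gt0 Im_gt0.
have ImM : I * m <= M by rewrite leq_pmulr.
have [e [he ltMe leeM]] := exponent_valuation (pickle (I, N)) M_gt0.
(* [I * m * (N * s).+1 = I * m + M * s] is the first term beyond [2 ^ e]. *)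
set s := ((2 ^ e - I * m) %/ M).+1.
have fN : (N * s).+1 = 1 %[mod N] by rewrite -addn1 mulnC modnMDl.
have val_f : I * m * (N * s).+1 = I * m + M * s by rewrite mulnS mulnA.
have lt_s : 2 ^ e - I * m < s * M by exact: ltn_ceil.
have le_s : s.-1 * M <= 2 ^ e - I * m by exact: leq_trunc_div.
have sS : s * M = M + s.-1 * M by rewrite -mulSn.
exists (N * s).+1; split.
- by split.
- rewrite ltnS leq_mul2l ltnS; apply/orP; right.
  rewrite -(leq_pmul2r M_gt0); apply: leq_trans le_s _.
  exact: leq_trans (leq_subr _ _) leeM.
- rewrite -mulnA; apply: (isolated_dyadic I_gt1 he).
  + by rewrite mulnA val_f mulnC; lia.
  + by rewrite mulnA val_f expnS (mulnC M); lia.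
  + by rewrite -modnMm mN fN modnMm muln1.
Qed.

Theorem theorem6p4 :
  exists A : set nat,
    [/\ A `<=` posnat,
        A `|` shift_down A = posnat
      & forall N I : nat, posnat N -> posnat I -> ~ mult_thick_in_coset I N A].
Proof.
exists [set n | 0 < n /\ ~~ isolated n]; split => [n [] //||N I].
  apply/seteqP; split => [n [] [] //|n n_gt0].
  case: (boolP (isolated n)) => [/andP[_ nSn]|]; last by left.
  by right; split => //; split => //; rewrite /isolated negb_and nSn.
rewrite /posnat /= => N_gt0 I_gt0 thick.
have I'_gt1 : 1 < I * N.+1 by nia.
have [X synd] := isolated_syndetic I'_gt1 N_gt0.
have NS : N.+1 = 1 %[mod N] by rewrite -addn1 modnDl.
pose F := [set f | cong_semigroup N f /\ f < (N.+1 * X).+1].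
have finF : finite_set F.
  by apply: sub_finite_set (finite_II (N.+1 * X).+1) => f [].
have [m mN sub] := thick F finF (fun f => @proj1 _ _).
have [f [[f_gt0 fN] fX]] := synd m mN.
apply/negP; rewrite (_ : _ * m * f = I * m * (N.+1 * f)); last by nia.
have [] // : [set n | 0 < n /\ ~~ isolated n] (I * m * (N.+1 * f)).
apply: sub; exists (N.+1 * f) => //; split; last by rewrite ltnS leq_mul2l fX orbT.
split; first by rewrite /posnat /= muln_gt0.
by rewrite -modnMm NS fN modnMm.
Qed.
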